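(* Let $\Lambda$ be an Artin algebra with an idempotent $e$. Assume that the functor $e(-)\colon\operatorname{mod}\text{-}\Lambda\to\operatorname{mod}\text{-}e\Lambda e$ is a $t$-eventually homological isomorphism. Then: (i) $\operatorname{fin.dim}e\Lambda e\le\max\{\operatorname{fin.dim}\Lambda,t\}$. (ii) $\operatorname{fin.dim}\Lambda\le\max\{\operatorname{fin.dim}e\Lambda e,t\}$. In particular, $\operatorname{fin.dim}\Lambda$ is finite if and only if $\operatorname{fin.dim}e\Lambda e$ is finite.
   Context: $\operatorname{mod}\text{-}\Lambda$ is the category of finitely generated right $\Lambda$-modules. The functor $e(-)$ is multiplication by the idempotent, which for right modules is $M\mapsto Me\simeq\operatorname{Hom}_\Lambda(e\Lambda,M)$. A functor $E\colon\mathscr B\to\mathscr C$ between abelian categories is an eventually homological isomorphism if there is a positive integer $t$ such that for every $n>t$ and all objects $B,B'$ of $\mathscr B$ there is a group isomorphism $\operatorname{Ext}^n_{\mathscr B}(B,B')\simeq\operatorname{Ext}^n_{\mathscr C}(E(B),E(B'))$ (not required to be induced by $E$); for the minimal such $t$ it is called a $t$-eventually homological isomorphism. $\operatorname{fin.dim}\Lambda$ is the supremum of the projective dimensions of all finitely generated right $\Lambda$-modules of finite projective dimension. *)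

(* Defs.v *)
From HB Require Import structures.
From mathcomp Require Import all_boot all_order all_algebra.
From mathcomp Require Import all_classical constructive_ereal.

Set Implicit Arguments.
Unset Strict Implicit.
Unset Printing Implicit Defensive.

Import Order.TTheory GRing.Theory Num.Theory.

Local Open Scope classical_set_scope.
Local Open Scope ring_scope.

Definition is_ideal (R : comPzRingType) (I : set R) : Prop :=
  [/\ I 0, (forall x y, I x -> I y -> I (x + y)) &
      (forall a x, I x -> I (a * x))].

Definition artinian (R : comPzRingType) : Prop :=
  forall I : nat -> set R, (forall k, is_ideal (I k)) ->
    (forall k, I k.+1 `<=` I k) ->
    exists m, forall k, (m <= k)%N -> I k = I m.

(* The R-algebra structure on L is given by its structure morphism, and not by
   [algType R], because the algebras of the library are nonzero rings. *)
Definition artin_algebra (R : comPzRingType) (L : pzRingType)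
    (iota : {rmorphism R -> L}) : Prop :=
  [/\ artinian R,
      (forall a x, iota a * x = x * iota a) &
      exists s : seq L, forall x, exists c : nat -> R,
        x = \sum_(i < size s) iota (c i) * s`_i].

Section Modules.
Variable A : pzRingType.
Implicit Types M N : lmodType A.

Definition fin_gen M : Prop :=
  exists s : seq M, forall x, exists c : nat -> A,
    x = \sum_(i < size s) c i *: s`_i.

Definition projective (P : lmodType A) : Prop :=
  forall (X Y : lmodType A) (p : {linear X -> Y}) (f : {linear P -> Y}),
    (forall y, exists x, p x = y) ->
    exists g : {linear P -> X}, forall x, p (g x) = f x.

Record proj_res M := ProjRes {
  res_mod :> nat -> lmodType A;
  res_d : forall n, {linear res_mod n.+1 -> res_mod n};
  res_aug : {linear res_mod 0 -> M};
  res_fin_gen : forall n, fin_gen (res_mod n);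
  res_projective : forall n, projective (res_mod n);
  res_aug_surj : forall m, exists x, res_aug x = m;
  res_exact0 : forall x, res_aug x = 0 <-> exists y, res_d 0 y = x;
  res_exactS : forall n x, res_d n x = 0 <-> exists y, res_d n.+1 y = x }.

End Modules.

Section Ext.
Variables (A : pzRingType) (M N : lmodType A) (P : proj_res M) (n : nat).

Definition is_cocycle (f : P n -> N) : bool :=
  `[< linear f /\ forall x, f (res_d P n x) = 0 >].

Lemma is_cocycle_closed : zmod_closed is_cocycle.
Proof.
split=> [|f g /asboolP[lf f0] /asboolP[lg g0]]; apply/asboolP; split.
- by move=> a x y; rewrite /= scaler0 addr0.
- by [].
- by move=> a x y; rewrite !fctE lf lg scalerBr opprD addrACA.
- by move=> x; rewrite !fctE f0 g0 subrr.
Qed.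

HB.instance Definition _ :=
  GRing.isZmodClosed.Build (P n -> N) is_cocycle is_cocycle_closed.

Definition cocycle : Type := {f : P n -> N | is_cocycle f}.
HB.instance Definition _ := SubType.on cocycle.
HB.instance Definition _ := Choice.on cocycle.
HB.instance Definition _ := [SubChoice_isSubZmodule of cocycle by <:].

(* The complex starts in degree 0, so that its 0-coboundaries are zero. *)
Definition bounding : forall k, (P k -> N) -> Prop := fun k =>
  match k with
  | 0 => fun f => f = 0
  | m.+1 => fun f => exists g : {linear P m -> N}, f = g \o res_d P m
  end.

Definition is_coboundary (f : cocycle) : bool := `[< bounding (val f) >].

Lemma is_coboundary_closed : zmod_closed is_coboundary.
Proof.
have bounds0 k : @bounding k 0.
  by case: k => [|k] //=; exists \0; apply/funext.
have boundsB k (f g : P k -> N) : bounding f -> bounding g -> bounding (f - g).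
  case: k f g => [|k] f g /=; first by move=> -> ->; rewrite subrr.
  move=> [f' ->] [g' ->]; exists (f' \- g'); exact/funext.
split=> [|f g /asboolP bf /asboolP bg]; apply/asboolP.
  by rewrite raddf0.
by rewrite raddfB; apply: boundsB.
Qed.

HB.instance Definition _ :=
  GRing.isZmodClosed.Build cocycle is_coboundary is_coboundary_closed.

(* The n-th cohomology group of the complex Hom_A(P, N) *)
Definition Ext : zmodType :=
  Quotient.quot (GRing.ZmodClosed.clone cocycle is_coboundary _).

End Ext.

Definition group_iso (G H : zmodType) : Prop :=
  exists f : {additive G -> H}, bijective f.

(* Ext^n(M, N) and Ext^n(M', N') are isomorphic; up to isomorphism, neither
   group depends on the resolution. *)
Definition Ext_iso (n : nat) (A : pzRingType) (M N : lmodType A)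
    (B : pzRingType) (M' N' : lmodType B) : Prop :=
  exists (P : proj_res M) (P' : proj_res M'),
    group_iso (Ext N P n) (Ext N' P' n).

(* [E] is the action on objects of a functor between the categories of finitely
   generated modules: the isomorphisms of Ext groups need not be induced by the
   functor, so that its action on morphisms plays no role. *)
Definition ev_hom_iso (A B : pzRingType) (E : lmodType A -> lmodType B)
    (t : nat) : Prop :=
  (0 < t)%N /\
  forall n, (t < n)%N -> forall M N : lmodType A, fin_gen M -> fin_gen N ->
    Ext_iso n M N (E M) (E N).

Definition t_ev_hom_iso (A B : pzRingType) (E : lmodType A -> lmodType B)
    (t : nat) : Prop :=
  ev_hom_iso E t /\ forall s, ev_hom_iso E s -> (t <= s)%N.

Definition pd_le (A : pzRingType) (M : lmodType A) (n : nat) : Prop :=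
  exists P : proj_res M, forall i, (n < i)%N -> forall x : P i, x = 0.

Definition proj_dim (A : pzRingType) (M : lmodType A) : \bar int :=
  infimum +oo%E [set (n%:Z)%:E%E | n in pd_le M].

Definition fin_dim (A : pzRingType) : \bar int :=
  supremum 0%E [set d | exists M : lmodType A,
    [/\ fin_gen M, d = proj_dim M & (d < +oo)%E]].

(* Right modules over L are left modules over the converse ring. *)
Definition rmodType (L : pzRingType) := lmodType L^c.

Definition rfin_dim (L : pzRingType) : \bar int := fin_dim L^c.

Section Corner.
Variables (L : pzRingType) (e : L) (he : e * e = e).

Definition in_corner (x : L) : bool := e * x * e == x.

Lemma in_corner_closed : zmod_closed in_corner.
Proof.
split=> [|x y /eqP hx /eqP hy]; apply/eqP; first by rewrite mulr0 mul0r.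
by rewrite mulrBr mulrBl hx hy.
Qed.

HB.instance Definition _ := GRing.isZmodClosed.Build L in_corner in_corner_closed.

(* [he] is a parameter of the type so that e can be its unit. *)
Definition corner of e * e = e : Type := {x : L | in_corner x}.

Local Notation eLe := (corner he).

HB.instance Definition _ := SubType.on eLe.
HB.instance Definition _ := Choice.on eLe.
HB.instance Definition _ := [SubChoice_isSubZmodule of eLe by <:].

Lemma corner_l (x : eLe) : e * val x = val x.
Proof. by rewrite -(eqP (valP x)) !mulrA he. Qed.

Lemma corner_r (x : eLe) : val x * e = val x.
Proof. by rewrite -(eqP (valP x)) -!mulrA he. Qed.

Lemma corner_one_subproof : in_corner e.
Proof. by rewrite /in_corner !he. Qed.

Lemma corner_mul_subproof (x y : eLe) : in_corner (val x * val y).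
Proof. by apply/eqP; rewrite mulrA corner_l -mulrA corner_r. Qed.

Definition corner_one : eLe := Sub e corner_one_subproof.
Definition corner_mul (x y : eLe) : eLe :=
  Sub (val x * val y) (corner_mul_subproof x y).

Lemma corner_mulA : associative corner_mul.
Proof. by move=> x y z; apply: val_inj; rewrite /= mulrA. Qed.
Lemma corner_mul1l : left_id corner_one corner_mul.
Proof. by move=> x; apply: val_inj; exact: corner_l. Qed.
Lemma corner_mul1r : right_id corner_one corner_mul.
Proof. by move=> x; apply: val_inj; exact: corner_r. Qed.
Lemma corner_mulDl : left_distributive corner_mul +%R.
Proof. by move=> x y z; apply: val_inj; rewrite /= mulrDl. Qed.
Lemma corner_mulDr : right_distributive corner_mul +%R.
Proof. by move=> x y z; apply: val_inj; rewrite /= mulrDr. Qed.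

HB.instance Definition _ := GRing.Zmodule_isPzRing.Build eLe
  corner_mulA corner_mul1l corner_mul1r corner_mulDl corner_mulDr.

Section CornerModule.
Variable M : rmodType L.

(* An element of M is of the form m e if and only if it is fixed by e. *)
Definition in_Me (m : M) : bool := (e : L^c) *: m == m.

Lemma in_Me_closed : zmod_closed in_Me.
Proof.
split=> [|x y /eqP hx /eqP hy]; apply/eqP; first by rewrite scaler0.
by rewrite scalerBr hx hy.
Qed.

HB.instance Definition _ := GRing.isZmodClosed.Build M in_Me in_Me_closed.

Definition corner_mod of e * e = e : Type := {m : M | in_Me m}.

Local Notation Me := (corner_mod he).

HB.instance Definition _ := SubType.on Me.
HB.instance Definition _ := Choice.on Me.
HB.instance Definition _ := [SubChoice_isSubZmodule of Me by <:].

Lemma corner_scale_subproof (x : eLe^c) (m : Me) :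
  in_Me ((val (x : eLe) : L^c) *: val m).
Proof. by apply/eqP; rewrite scalerA -[in RHS](corner_r x). Qed.

Definition corner_scale (x : eLe^c) (m : Me) : Me :=
  Sub ((val (x : eLe) : L^c) *: val m) (corner_scale_subproof x m).

Lemma corner_scaleA x y m :
  corner_scale x (corner_scale y m) = corner_scale (x * y) m.
Proof. by apply: val_inj; rewrite /= scalerA. Qed.
Lemma corner_scale1 : left_id 1 corner_scale.
Proof. by move=> m; apply: val_inj; exact/eqP/(valP m). Qed.
Lemma corner_scaleDr : right_distributive corner_scale +%R.
Proof. by move=> x m n; apply: val_inj; rewrite /= scalerDr. Qed.
Lemma corner_scaleDl m : {morph corner_scale^~ m : x y / x + y}.
Proof. by move=> x y; apply: val_inj; rewrite /= scalerDl. Qed.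

HB.instance Definition _ := GRing.Zmodule_isLmodule.Build eLe^c Me
  corner_scaleA corner_scale1 corner_scaleDr corner_scaleDl.

End CornerModule.

Definition mul_e (M : rmodType L) : rmodType eLe := corner_mod M he.

End Corner.

(* Main.v *)
(* If M has a resolution P by finitely generated projectives, then pd M <= n as
   soon as Ext^(n+1)(M, N) = 0 for all finitely generated N: take for N the image
   of P_(n+1) -> P_n; the class of P_(n+1) -> N vanishes, so that N is a direct
   summand of P_n and the resolution can be cut off there.  Moreover every
   finitely generated module over eLe has the form Me with M finitely generated
   over L.  Hence, for n >= t, Me has projective dimension at most n if M does,
   and conversely.  Given M of finite projective dimension, Me has finite
   projective dimension too, hence one at most the finitistic dimension of eLe,
   and going back to M gives (ii); (i) is symmetric. *)
From HB Require Import structures.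
Require Import Defs.
From mathcomp Require Import all_boot all_order all_algebra.
From mathcomp Require Import all_classical constructive_ereal.

Set Implicit Arguments.
Unset Strict Implicit.
Unset Printing Implicit Defensive.

Import Order.TTheory GRing.Theory Num.Theory.

Local Open Scope ring_scope.

(** * Submodules, images and lifting through projectives *)

Section Submodule.
Variables (A : pzRingType) (M : lmodType A) (S : {pred M}).

(** The closure proof is an argument so that the submodule structure can be attached to an arbitrary
    [S]. *)
Definition submod_pred of submod_closed S : {pred M} := S.

Variable hS : submod_closed S.

HB.instance Definition _ :=
  GRing.isSubmodClosed.Build A M (submod_pred hS) hS.

Definition submod : Type := {x : M | submod_pred hS x}.
HB.instance Definition _ := SubType.on submod.
HB.instance Definition _ := Choice.on submod.
HB.instance Definition _ := [SubChoice_isSubLmodule of submod by <:].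

Section Corestriction.
Variables (X : lmodType A) (f : {linear X -> M}) (hf : forall x, f x \in S).

Definition corestr (x : X) : submod := Sub (f x) (hf x).

Lemma corestr_linear : linear corestr.
Proof. by move=> a x y; apply: val_inj; rewrite /= linearP. Qed.

HB.instance Definition _ := GRing.isLinear.Build A X submod _ corestr
  corestr_linear.
End Corestriction.
End Submodule.

Section Range.
Variables (A : pzRingType) (X Y : lmodType A) (f : {linear X -> Y}).

Definition in_range (y : Y) : bool := `[< exists x, f x = y >].

Lemma in_range_closed : submod_closed in_range.
Proof.
split=> [|a x y /asboolP[x' <-] /asboolP[y' <-]]; apply/asboolP.
  by exists 0; rewrite linear0.
by exists (a *: x' + y'); rewrite linearP.
Qed.

Definition lrange : lmodType A := submod in_range_closed.

Lemma in_range_image x : f x \in in_range.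
Proof. by apply/asboolP; exists x. Qed.

Definition to_lrange : {linear X -> lrange} :=
  corestr in_range_closed in_range_image.

Lemma to_lrange_surj y : exists x, to_lrange x = y.
Proof. by have /asboolP[x hx] := valP y; exists x; apply: val_inj. Qed.

End Range.

Section Modules.
Variable A : pzRingType.

Lemma fin_gen_surj (X Y : lmodType A) (f : {linear X -> Y}) :
  (forall y, exists x, f x = y) -> fin_gen X -> fin_gen Y.
Proof.
move=> fsurj [s hs]; exists (map f s) => y; have [x <-] := fsurj y.
have [c ->] := hs x; exists c; rewrite linear_sum size_map.
by apply: eq_bigr => i _; rewrite linearZ (nth_map 0).
Qed.

(** [projective] speaks of surjections only, so both maps are first corestricted to the image of
    [p]. *)
Lemma projective_lift (P X Y : lmodType A) (p : {linear X -> Y})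
    (f : {linear P -> Y}) : projective P ->
  (forall x, exists z, p z = f x) ->
  exists g : {linear P -> X}, forall x, p (g x) = f x.
Proof.
move=> projP h.
have hf x : f x \in in_range p by apply/asboolP.
have [g hg] := projP _ _ (to_lrange p) (corestr (in_range_closed p) hf)
  (@to_lrange_surj _ _ _ p).
by exists g => x; have := congr1 val (hg x).
Qed.

Lemma projective_retract (P Q : lmodType A) (i : {linear Q -> P})
    (r : {linear P -> Q}) : cancel i r -> projective P -> projective Q.
Proof.
move=> ir projP X Y p f psurj.
have [g hg] := projP X Y p (f \o r) psurj.
by exists (g \o i) => x; rewrite /= hg /= ir.
Qed.

End Modules.

(** Dependent choice across varying types, for building chain maps and homotopies degree by degree;
    [ok] is the invariant that makes the next choice possible. *)
Lemma dependent_chain (T : nat -> Type) (ok : forall n, T n -> Prop)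
    (next : forall n, T n -> T n.+1 -> Prop) (x0 : T 0) : ok 0 x0 ->
  (forall n x, ok n x -> exists2 y, next n x y & ok n.+1 y) ->
  exists2 f : forall n, T n, f 0 = x0 & forall n, next n (f n) (f n.+1).
Proof.
move=> ok0 okS.
have step n (s : {x : T n | ok n x}) :
    {s' : {x : T n.+1 | ok n.+1 x} | next n (sval s) (sval s')}.
  by apply: cid; have [y ny oky] := okS n _ (svalP s); exists (exist _ y oky).
pose F := nat_rect (fun n => {x : T n | ok n x}) (exist _ x0 ok0)
  (fun n s => sval (step n s)).
by exists (fun n => sval (F n)) => // n; exact: svalP (step n (F n)).
Qed.

(** * Comparison of projective resolutions *)

Section Comparison.
Variable A : pzRingType.

Section Complex.
Variables (M : lmodType A) (P : proj_res M).

Lemma res_augd x : res_aug P (res_d P 0 x) = 0.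
Proof. by apply/res_exact0; exists x. Qed.

Lemma res_dd n x : res_d P n (res_d P n.+1 x) = 0.
Proof. by apply/res_exactS; exists x. Qed.

End Complex.

Variables (M : lmodType A) (P Q : proj_res M).

Definition chain_map (f : forall n, {linear P n -> Q n}) : Prop :=
  forall n x, res_d Q n (f n.+1 x) = f n (res_d P n x).

Lemma comparison : exists2 f : forall n, {linear P n -> Q n},
  forall x, res_aug Q (f 0 x) = res_aug P x & chain_map f.
Proof.
have [f0 hf0] := (@res_projective _ _ P 0) _ _ (res_aug Q) (res_aug P)
  (res_aug_surj Q).
(* Invariant: [f] sends boundaries to boundaries, so that [f \o res_d P n] lifts through
   [res_d Q n]. *)
have [||f f0E hf] := @dependent_chain (fun n => {linear P n -> Q n})
  (fun n f => forall x, exists z, res_d Q n z = f (res_d P n x))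
  (fun n f g => forall x, res_d Q n (g x) = f (res_d P n x)) f0.
- by move=> x; apply/res_exact0; rewrite hf0 res_augd.
- move=> n f hf.
  have [g hg] := projective_lift (p := res_d Q n) (f := f \o res_d P n)
    (@res_projective _ _ P n.+1) hf.
  exists g => // x.
  by apply/res_exactS; rewrite hg /= res_dd linear0.
by exists f => //; rewrite f0E.
Qed.

Lemma null_homotopy (u : forall n, {linear P n -> Q n}) :
    (forall x, res_aug Q (u 0 x) = 0) -> chain_map u ->
  exists h : forall n, {linear P n -> Q n.+1},
    forall n x, u n.+1 x = res_d Q n.+1 (h n.+1 x) + h n (res_d P n x).
Proof.
move=> u0 uS.
have [|h0 hh0] := projective_lift (p := res_d Q 0) (f := u 0)
    (@res_projective _ _ P 0).
  by move=> x; apply/res_exact0.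
(* Invariant: d h = u on boundaries. Then u - h d takes values in cycles, so by exactness it lifts
   through the next differential. *)
have [||h _ hh] := @dependent_chain (fun n => {linear P n -> Q n.+1})
  (fun n h => forall x, res_d Q n (h (res_d P n x)) = u n (res_d P n x))
  (fun n h k => forall x,
     u n.+1 x = res_d Q n.+1 (k x) + h (res_d P n x)) h0.
- by move=> x; rewrite hh0.
- move=> n h hh.
  have [|k hk] := projective_lift (p := res_d Q n.+1)
      (f := u n.+1 \- (h \o res_d P n)) (@res_projective _ _ P n.+1).
    by move=> x; apply/res_exactS; rewrite /= linearB /= uS hh subrr.
  exists k => x; rewrite hk /= ?subrK // res_dd linear0 subr0.
  by [].
by exists h.
Qed.

End Comparison.

(** * Vanishing of Ext groups *)

Section ExtVanishing.
Variable A : pzRingType.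
Implicit Types M N : lmodType A.

(** The index is shifted: this is vanishing in degree [n.+1], where coboundaries come from [P n]. *)
Definition ext_vanish M N (P : proj_res M) n : Prop :=
  forall f : {linear P n.+1 -> N}, (forall x, f (res_d P n.+1 x) = 0) ->
    exists g : {linear P n -> N}, forall x, f x = g (res_d P n x).

Lemma ext_vanishP M N (P : proj_res M) n :
  ext_vanish N P n <-> forall z : Ext N P n.+1, z = 0.
Proof.
split=> [h z|h f f0].
  (* With both sides written as classes, equality in the quotient becomes membership of the
     difference among the coboundaries. *)
  rewrite -[z]reprK -[RHS](raddf0 (\pi_(Ext N P n.+1))%qT).
  apply/eqP; rewrite -Quotient.idealrBE subr0.
  have /asboolP[lf f0] := valP (repr z).
  pose F := GRing.isLinear.Build _ _ _ _ _ lf.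
  pose f : {linear P n.+1 -> N} := HB.pack (val (repr z)) F.
  have [g hg] := h f f0.
  by apply/asboolP; exists g; apply/funext.
have cf : is_cocycle (f : P n.+1 -> N).
  by apply/asboolP; split => //; exact: linearP.
pose z : cocycle N P n.+1 := Sub (f : P n.+1 -> N) cf.
have /eqP := h (\pi z)%qT.
rewrite -(raddf0 (\pi_(Ext N P n.+1))%qT) -Quotient.idealrBE subr0.
by move=> /asboolP[g hg]; exists g => x; rewrite -[LHS]/(val z x) hg.
Qed.

(** Let f and g compare the resolutions both ways, with id - g f = d h + h d. A cocycle phi on [Q]
    has phi g = psi d on [P], whence phi = (psi f + phi h) d. *)
Lemma ext_vanish_indep M N (P Q : proj_res M) n :
  ext_vanish N P n -> ext_vanish N Q n.
Proof.
move=> hP phi phi0.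
have [f f0 fd] := comparison Q P; have [g g0 gd] := comparison P Q.
have [||h hh] := @null_homotopy _ _ Q Q (fun n => idfun \- (g n \o f n)).
- by move=> x; rewrite /= linearB /= g0 f0 subrr.
- by move=> k x; rewrite /= linearB /= gd fd.
have [|psi hpsi] := hP (phi \o g n.+1).
  by move=> x; rewrite /= -gd.
exists ((psi \o f n) \+ (phi \o h n)) => x /=.
rewrite -fd -hpsi /=; have := hh n x => /= /(canRL (subrK _)) {1}->.
by rewrite !linearD /= phi0 add0r addrC.
Qed.

(** The hypothesis makes [N'] a direct summand of [N]: a cocycle is pushed into [N], bounded there
    and retracted. *)
Lemma ext_vanish_iso M N N' (P : proj_res M) n (i : {linear N -> N'})
    (j : {linear N' -> N}) :
  cancel j i -> ext_vanish N P n -> ext_vanish N' P n.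
Proof.
move=> ij h f f0; have [|g hg] := h (j \o f).
  by move=> x; rewrite /= f0 linear0.
by exists (i \o g) => x; rewrite /= -hg /= ij.
Qed.

Lemma pd_le_ext_vanish M N (P : proj_res M) d n :
  pd_le M d -> (d <= n)%N -> ext_vanish N P n.
Proof.
move=> [Q Q0] dn; apply: (@ext_vanish_indep M N Q) => f _.
by exists \0 => x; rewrite [x]Q0 // linear0.
Qed.

End ExtVanishing.

(** [Ext_iso] provides one pair of resolutions; independence of the resolution moves the vanishing
    to and from that pair. *)
Lemma Ext_iso_vanish (A B : pzRingType) n (M N : lmodType A)
    (M' N' : lmodType B) :
  Ext_iso n.+1 M N M' N' ->
  (exists P : proj_res M, ext_vanish N P n) <->
  (exists P : proj_res M', ext_vanish N' P n).
Proof.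
move=> [P [P' [f [g fK gK]]]]; split=> -[Q hQ]; [exists P'|exists P].
  apply/ext_vanishP => z; rewrite -(gK z).
  have /ext_vanishP/(_ (g z)) -> := ext_vanish_indep (Q := P) hQ.
  exact: raddf0.
apply/ext_vanishP => z; apply: (can_inj fK); rewrite raddf0.
by have /ext_vanishP := ext_vanish_indep (Q := P') hQ; apply.
Qed.

(** * Truncation of a resolution by idempotents *)

Section Truncation.
Variables (A : pzRingType) (M : lmodType A) (P : proj_res M) (n : nat).

(* The idempotents [rho] cut the resolution down to
   0 -> rho (P n) -> P n.-1 -> ... -> P 0. *)
Lemma idempotents_pd_le (rho : forall i, {linear P i -> P i}) :
    (forall i x, (i < n)%N -> rho i x = x) ->
    (forall i x, (n < i)%N -> rho i x = 0) ->
    (forall x, rho n (res_d P n x) = 0) ->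
    (forall x, exists y, x - rho n x = res_d P n y) ->
  pd_le M n.
Proof.
move=> rho_lt rho_gt rho_d rho_sub.
have idem i x : rho i (rho i x) = rho i x.
  have [/rho_lt ->//|/rho_gt h|ein] := ltngtP i n; first by rewrite !h.
  subst i; have [y /(canRL (subrK _)) h] := rho_sub x.
  by rewrite [in RHS]h linearD /= rho_d add0r.
have fix_rho i (x : lrange (rho i)) : rho i (val x) = val x.
  by have /asboolP[y <-] := valP x.
(* The only case with content is [i.+1 = n], where [rho] changes [x] by a boundary. *)
have d_rho i x : (i < n)%N -> res_d P i (rho i.+1 x) = res_d P i x.
  move=> lt_in; have [lt_i1n|le_ni1] := ltnP i.+1 n; first by rewrite rho_lt.
  have ein : n = i.+1 by apply/eqP; rewrite eqn_leq lt_in le_ni1.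
  have hsub := rho_sub; rewrite ein in hsub.
  have [y /(canRL (subrK _)) h] := hsub x.
  by rewrite [in RHS]h linearD /= res_dd add0r.
have rho_d0 i x : (n <= i)%N -> rho i (res_d P i x) = 0.
  rewrite leq_eqVlt => /orP[/eqP ein|/rho_gt //].
  by have h := rho_d; rewrite ein in h.
have rho_d_rho i x : rho i (res_d P i (rho i.+1 x)) = rho i (res_d P i x).
  have [lt_in|le_ni] := ltnP i n; first by rewrite d_rho.
  by rewrite !rho_d0.
have aug_rho x : res_aug P (rho 0 x) = res_aug P x.
  have [|e0n] : (0 < n)%N \/ n = 0%N by case: (n) => [|?]; [right|left].
    by move/rho_lt ->.
  have hsub := rho_sub; rewrite e0n in hsub.
  have [y /(canRL (subrK _)) h] := hsub x.
  by rewrite [in RHS]h linearD /= res_augd add0r.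
pose U i : lmodType A := lrange (rho i).
(* Composing with [rho i] lands in [U i] in every degree; it changes nothing below [n] and gives the
   zero map from [n] on. *)
pose dU i : {linear U i.+1 -> U i} := to_lrange (rho i) \o (res_d P i \o val).
pose augU : {linear U 0%N -> M} := res_aug P \o val.
have dUE i y : val (dU i y) = rho i (res_d P i (val y)) by [].
have lift_d i (x : U i) y : val x = res_d P i y -> dU i (to_lrange _ y) = x.
  by move=> hxy; apply: val_inj; rewrite dUE /= rho_d_rho -hxy fix_rho.
have fgU i : fin_gen (U i).
  exact: fin_gen_surj (to_lrange_surj (f := rho i)) (@res_fin_gen _ _ P i).
have projU i : projective (U i).
  apply: (@projective_retract _ (P i) _ val (to_lrange (rho i))).
    by move=> x; apply: val_inj; rewrite /= fix_rho.
  exact: res_projective.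
have augU_surj m : exists x, augU x = m.
  have [x <-] := res_aug_surj P m.
  by exists (to_lrange _ x); rewrite /augU /= aug_rho.
have exact0 x : augU x = 0 <-> exists y, dU 0 y = x.
  split=> [/res_exact0[y /esym hy]|[y <-]].
    by exists (to_lrange _ y); exact: lift_d.
  by rewrite /augU /= aug_rho res_augd.
have exactS i x : dU i x = 0 <-> exists y, dU i.+1 y = x.
  split=> [/(congr1 val)|[y <-]]; last first.
    by apply: val_inj; rewrite dUE dUE rho_d_rho res_dd linear0.
  (* From degree [n] on, [U i.+1] is zero and exactness there is trivial. *)
  rewrite dUE; have [lt_in|le_ni] := ltnP i n; last first.
    move=> _; exists 0; apply: val_inj.
    by rewrite linear0 -[RHS]fix_rho rho_gt.
  rewrite rho_lt // => /res_exactS[y /esym hy].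
  by exists (to_lrange _ y); exact: lift_d.
exists (ProjRes fgU projU augU_surj exact0 exactS) => i lt_ni x.
by apply: val_inj; rewrite -[LHS]fix_rho rho_gt.
Qed.

(** Here [s] is a projection of [P n] onto the image of [res_d P n]; in degree [n] the resolution is
    cut by the complementary projection id - s. *)
Lemma split_pd_le (s : {linear P n -> P n}) :
    (forall y, s (res_d P n y) = res_d P n y) ->
    (forall x, exists y, s x = res_d P n y) ->
  pd_le M n.
Proof.
move=> sd s_im.
(* The clause for degree [n] is guarded by [i = n], because the type of [rho] depends on [i] while
   [s] lives in degree [n] only. *)
have ex_rho i : {rho : {linear P i -> P i} |
    [/\ forall x, (i < n)%N -> rho x = x, forall x, (n < i)%N -> rho x = 0 &
        i = n -> (forall x, rho (res_d P i x) = 0) /\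
          forall x, exists y, x - rho x = res_d P i y]}.
  apply: cid; have [lt_in|lt_ni|->] := ltngtP i n.
  - by exists idfun; split=> [//|x lt_ni|e]; move: lt_in;
      rewrite ?e ?ltnn // ltnNge ltnW.
  - by exists \0; split=> [x lt_in|//|e]; move: lt_ni;
      rewrite ?e ?ltnn // ltnNge ltnW.
  - exists (idfun \- s); split=> // _; split=> x /=.
      by rewrite sd subrr.
    by rewrite opprB addrC subrK.
pose rho i := sval (ex_rho i).
have rhoP i := svalP (ex_rho i).
have [_ _ /(_ erefl)[rho_d rho_sub]] := rhoP n.
apply: (@idempotents_pd_le rho) => // i x lt_i.
  by have [h _ _] := rhoP i; exact: h.
by have [_ h _] := rhoP i; exact: h.
Qed.

Lemma ext_vanish_pd_le :
  (forall N : lmodType A, fin_gen N -> ext_vanish N P n) -> pd_le M n.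
Proof.
move=> vanish; pose delta := to_lrange (res_d P n).
have fgN : fin_gen (lrange (res_d P n)).
  exact: fin_gen_surj (to_lrange_surj (f := res_d P n))
    (@res_fin_gen _ _ P n.+1).
have [|g hg] := vanish _ fgN delta.
  by move=> x; apply: val_inj; rewrite /= res_dd.
(* The equation for [g] says that it restricts to the identity on the image of [res_d P n]. *)
apply: (@split_pd_le (val \o g)) => [y|x] /=; first by rewrite -hg.
by have [y <-] := to_lrange_surj (g x); exists y.
Qed.

End Truncation.

(** * Projective and finitistic dimensions as extended integers *)

Section ProjDim.
Variables (A : pzRingType) (M : lmodType A).

Lemma proj_dim_pinfty : ~ (exists n, pd_le M n) -> proj_dim M = +oo%E.
Proof.
move=> none; rewrite /proj_dim /infimum ifT //; apply/eqP; rewrite -subset0.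
by move=> x [n hn _]; apply: none; exists n.
Qed.

(** [infimum] is a chosen element of [infimums], so its value follows from exhibiting one infimum
    and from uniqueness. *)
Lemma proj_dim_fin n : pd_le M n -> (forall m, pd_le M m -> (n <= m)%N) ->
  proj_dim M = (n%:Z)%:E%E.
Proof.
move=> hn nmin; set x := (n%:Z)%:E%E.
rewrite /proj_dim; set D := (X in infimum _ X).
have Dx : D x by exists n.
have inf_x : infimums D x.
  split=> [_ [m hm <-]|y hy]; last exact: hy.
  by rewrite lee_fin lez_nat; exact: nmin.
rewrite /infimum ifF; last by apply/eqP => D0; rewrite D0 in Dx.
by apply: (is_subset1_infimums (A := D)) => //; apply: xgetPex; exists x.
Qed.

Lemma proj_dim_attained n : pd_le M n ->
  exists2 m, proj_dim M = (m%:Z)%:E%E & pd_le M m.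
Proof.
move=> hn; have ex : exists n, `[< pd_le M n >] by exists n; apply/asboolP.
have [m /asboolP hm mmin] := ex_minnP ex; exists m => //.
by apply: proj_dim_fin => // k hk; apply: mmin; apply/asboolP.
Qed.

Lemma proj_dim_le n : pd_le M n -> (proj_dim M <= (n%:Z)%:E)%E.
Proof.
move=> hn; have ex : exists n, `[< pd_le M n >] by exists n; apply/asboolP.
have [m /asboolP hm mmin] := ex_minnP ex.
rewrite (proj_dim_fin hm) => [|k hk]; last by apply: mmin; apply/asboolP.
by rewrite lee_fin lez_nat; apply: mmin; apply/asboolP.
Qed.

End ProjDim.

(** Existence has to be shown, since [supremum] otherwise falls back on its default. A bounded set
    has a maximum; an unbounded one has supremum [+oo]. *)
Lemma nat_ereal_supremums (S : set nat) : (S !=set0)%classic ->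
  (supremums [set (n%:Z)%:E%E | n in S] !=set0)%classic.
Proof.
move=> [n0 Sn0].
have [[b Sb]|unbounded] := pselect (exists b, forall n, S n -> (n <= b)%N).
  have [||m /asboolP Sm mmax] := @ex_maxnP (fun n => `[< S n >]) b.
  - by exists n0; apply/asboolP.
  - by move=> n /asboolP; exact: Sb.
  exists (m%:Z)%:E%E; split=> [_ [n Sn <-]|x]; last by apply; exists m.
  by rewrite lee_fin lez_nat; apply: mmax; apply/asboolP.
exists +oo%E; split=> [x _|x hx]; first exact: leey.
case: x hx => [z| |] hx; [| exact: lexx |]; last first.
  by have := hx _ (ex_intro2 _ _ n0 Sn0 erefl).
(* An integer upper bound [z] would yield the natural bound [|z|]. *)
case: unbounded; exists `|z|%N => n Sn.
have := hx _ (ex_intro2 _ _ n Sn erefl); rewrite lee_fin => le_nz.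
by rewrite -lez_nat abszE (le_trans le_nz) // ler_norm.
Qed.

Section FinDim.
Variable A : pzRingType.

Let dims := [set d : \bar int | exists M : lmodType A,
  [/\ fin_gen M, d = proj_dim M & (d < +oo)%E]]%classic.

(** A projective dimension below [+oo] is a natural number, so the previous existence result applies
    to [dims]. *)
Lemma dims_supremums : (dims !=set0)%classic -> (supremums dims !=set0)%classic.
Proof.
pose S := [set n | dims (n%:Z)%:E%E]%classic.
have <- : [set (n%:Z)%:E%E | n in S]%classic = dims.
  apply/seteqP; split=> [_ [n Sn <-] //|d dd].
  have [M [_ dE]] := dd; rewrite dE.
  have [[n /proj_dim_attained[m mE _]] _|/proj_dim_pinfty -> //] :=
    pselect (exists n, pd_le M n).
  by exists m; rewrite // /S /= -mE -dE.
by move=> [_ [n Sn _]]; apply: nat_ereal_supremums; exists n.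
Qed.

(** The bound [n] may exceed the finitistic dimension; [m] is the exact projective dimension. *)
Lemma fin_dim_ge (M : lmodType A) n : fin_gen M -> pd_le M n ->
  exists2 m, pd_le M m & ((m%:Z)%:E <= fin_dim A)%E.
Proof.
move=> fgM /proj_dim_attained[m mE hm]; exists m => //.
have dm : dims (m%:Z)%:E%E by exists M; split => //; rewrite ltry.
by apply: ge_supremum_Nmem => //; apply: dims_supremums; exists (m%:Z)%:E%E.
Qed.

(** Nonnegativity of [x] covers the default value 0 of the supremum of an empty set. *)
Lemma fin_dim_le (x : \bar int) : (0 <= x)%E ->
  (forall (M : lmodType A) n, fin_gen M -> pd_le M n -> (proj_dim M <= x)%E) ->
  (fin_dim A <= x)%E.
Proof.
move=> x0 hx; rewrite /fin_dim /supremum; case: ifPn => // /set0P dims0.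
have [_] : supremums dims (xget 0%E (supremums dims)).
  by apply: xgetPex; exact: dims_supremums.
apply=> d [M [fgM -> hM]].
have [[n hn]|/proj_dim_pinfty hy] := pselect (exists n, pd_le M n).
  exact: hx hn.
by rewrite hy ltxx in hM.
Qed.

End FinDim.

(** * Transfer of dimensions along an eventually homological isomorphism *)

Definition lmod_iso (A : pzRingType) (M N : lmodType A) : Prop :=
  exists (i : {linear M -> N}) (j : {linear N -> M}), cancel i j /\ cancel j i.

Lemma pd_le_iso (A : pzRingType) (M N : lmodType A) n :
  lmod_iso M N -> pd_le M n -> pd_le N n.
Proof.
move=> [i [j [ij ji]]] [P P0].
pose aug : {linear P 0%N -> N} := i \o res_aug P.
have aug_surj y : exists x, aug x = y.
  by have [x hx] := res_aug_surj P (j y); exists x; rewrite /aug /= hx ji.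
have exact0 x : aug x = 0 <-> exists y, res_d P 0 y = x.
  apply: iff_trans (res_exact0 x); rewrite /aug /=.
  by split=> [/(congr1 j)|->]; rewrite ?ij linear0.
by exists (ProjRes (@res_fin_gen _ _ P) (@res_projective _ _ P) aug_surj
  exact0 (@res_exactS _ _ P)).
Qed.

Section EventuallyHomological.
Variables (A B : pzRingType) (E : lmodType A -> lmodType B) (t : nat).
Hypothesis E_iso : ev_hom_iso E t.
Hypothesis E_surj : forall X : lmodType B, fin_gen X ->
  exists2 M, fin_gen M & lmod_iso (E M) X.

(** An [Ext_iso] carries resolutions of both modules; degree [t.+1] with [N = M] supplies one. *)
Lemma ev_hom_iso_res (M : lmodType A) : fin_gen M ->
  exists (P : proj_res M) (P' : proj_res (E M)), True.
Proof.
move=> fgM; have [P [P' _]] := E_iso.2 t.+1 (ltnSn t) M M fgM fgM.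
by exists P, P'.
Qed.

Lemma ev_hom_iso_fin_gen (M : lmodType A) : fin_gen M -> fin_gen (E M).
Proof.
move=> /ev_hom_iso_res[_ [P _]].
exact: fin_gen_surj (res_aug_surj P) (@res_fin_gen _ _ P 0).
Qed.

(** Degree [(maxn d t).+1] exceeds [d], so Ext vanishes over [A], and exceeds [t], so the vanishing
    passes to [B]. By [E_surj] the modules [E N] exhaust all coefficients up to isomorphism. *)
Lemma pd_le_image (M : lmodType A) d : fin_gen M -> pd_le M d ->
  pd_le (E M) (maxn d t).
Proof.
move=> fgM pdM; have [P [P' _]] := ev_hom_iso_res fgM.
apply: (@ext_vanish_pd_le _ _ P') => X /E_surj[N fgN [i [j [_ ji]]]].
apply: (ext_vanish_iso ji).
have [|//|P'' hP''] :=
  (Ext_iso_vanish (E_iso.2 (maxn d t).+1 _ M N fgM fgN)).1.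
- by rewrite ltnS leq_maxr.
- by exists P; apply: pd_le_ext_vanish pdM _; exact: leq_maxl.
- exact: ext_vanish_indep hP''.
Qed.

Lemma pd_le_preimage (M : lmodType A) d : fin_gen M -> pd_le (E M) d ->
  pd_le M (maxn d t).
Proof.
move=> fgM pdEM; have [P [P' _]] := ev_hom_iso_res fgM.
apply: (@ext_vanish_pd_le _ _ P) => N fgN.
have [|//|P'' hP''] :=
  (Ext_iso_vanish (E_iso.2 (maxn d t).+1 _ M N fgM fgN)).2.
- by rewrite ltnS leq_maxr.
- by exists P'; apply: pd_le_ext_vanish pdEM _; exact: leq_maxl.
- exact: ext_vanish_indep hP''.
Qed.

Lemma maxn_le_maxe m (x : \bar int) : ((m%:Z)%:E <= x)%E ->
  (((maxn m t)%:Z)%:E <= maxe x (t%:Z)%:E)%E.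
Proof.
by move=> lemx; rewrite le_max; case: leqP; rewrite ?lemx ?lexx ?orbT.
Qed.

Lemma maxe_nat_ge0 (x : \bar int) : (0 <= maxe x (t%:Z)%:E)%E.
Proof. by rewrite le_max lee_fin orbT. Qed.

(** The bound from [d] only shows that [M] has finite projective dimension; this is then improved to
    some [m] below [fin_dim A] and carried back to [X]. *)
Lemma ev_hom_iso_fin_dim_le : (fin_dim B <= maxe (fin_dim A) (t%:Z)%:E)%E.
Proof.
apply: fin_dim_le (maxe_nat_ge0 _) _ => X d /E_surj[M fgM EMX] pdX.
have pdEM : pd_le (E M) d.
  by case: EMX => i [j [ij ji]]; apply: pd_le_iso pdX; exists j, i.
have [m pdM le_m] := fin_dim_ge fgM (pd_le_preimage fgM pdEM).
apply: le_trans (maxn_le_maxe le_m).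
by apply: proj_dim_le; apply: pd_le_iso EMX _; exact: pd_le_image.
Qed.

Lemma ev_hom_iso_fin_dim_ge : (fin_dim A <= maxe (fin_dim B) (t%:Z)%:E)%E.
Proof.
apply: fin_dim_le (maxe_nat_ge0 _) _ => M d fgM pdM.
have [m pdEM le_m] :=
  fin_dim_ge (ev_hom_iso_fin_gen fgM) (pd_le_image fgM pdM).
apply: le_trans (maxn_le_maxe le_m).
by apply: proj_dim_le; exact: pd_le_preimage.
Qed.

End EventuallyHomological.

(** * Finitely generated submodules *)

Section Span.
Variables (A : pzRingType) (M : lmodType A) (s : seq M).

Definition in_span (x : M) : bool :=
  `[< exists c : nat -> A, x = \sum_(i < size s) c i *: s`_i >].

Lemma in_span_closed : submod_closed in_span.
Proof.
split=> [|a x y /asboolP[c ->] /asboolP[d ->]]; apply/asboolP.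
  by exists (fun=> 0); rewrite big1 // => i _; rewrite scale0r.
exists (fun i => a * c i + d i); rewrite scaler_sumr -big_split.
by apply: eq_bigr => i _; rewrite scalerDl scalerA.
Qed.

Definition span : lmodType A := submod in_span_closed.

Lemma mem_in_span (i : 'I_(size s)) : in_span s`_i.
Proof.
apply/asboolP; exists (fun k => (k == i :> nat)%:R).
rewrite (bigD1 i) //= eqxx scale1r big1 ?addr0 // => j /negPf jni.
by rewrite [_ == _ :> nat]jni scale0r.
Qed.

Lemma span_fin_gen : fin_gen span.
Proof.
exists [seq (Sub s`_i (mem_in_span i) : span) |
  i : 'I_(size s) <- enum 'I_(size s)] => x.
have /asboolP[c xE] := valP x; exists c; apply: val_inj.
rewrite size_map size_enum_ord linear_sum /= xE; apply: eq_bigr => i _.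
by rewrite (nth_map i) ?size_enum_ord //= nth_ord_enum.
Qed.

End Span.

(** * Coinduction from the corner ring *)

Section Corner.
Variables (L : pzRingType) (e : L) (he : e * e = e).
Local Notation eLe := (corner he).

Lemma to_corner_subproof x : in_corner e (e * x * e).
Proof. by rewrite /in_corner !mulrA he -!mulrA he. Qed.

Definition to_corner (x : L) : eLe := Sub (e * x * e) (to_corner_subproof x).

Lemma to_corner1 : to_corner 1 = 1.
Proof. by apply: val_inj; rewrite /= mulr1 he. Qed.

Lemma to_corner_eM x : to_corner (e * x) = to_corner x.
Proof. by apply: val_inj; rewrite /= mulrA he. Qed.

Lemma to_corner_mul (a : eLe) x : a * to_corner x = to_corner (val a * x).
Proof.
by apply: val_inj; rewrite /= !mulrA corner_r corner_l.
Qed.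

Section Coinduction.
Variable X : rmodType eLe.

(** In right-module notation the second condition reads f(la) = f(l)a. *)
Definition is_coind (f : L -> X) : bool :=
  `[< zmod_morphism f /\
      forall l (a : eLe), f (l * val a) = (a : eLe^c) *: f l >].

Lemma is_coind_closed : zmod_closed is_coind.
Proof.
split=> [|f g /asboolP[fB fM] /asboolP[gB gM]]; apply/asboolP; split.
- by move=> x y; rewrite /= subr0.
- by move=> l a; rewrite /= scaler0.
- by move=> x y; rewrite !fctE fB gB !opprD addrACA.
- by move=> l a; rewrite !fctE fM gM scalerBr.
Qed.

HB.instance Definition _ :=
  GRing.isZmodClosed.Build (L -> X) is_coind is_coind_closed.

(* The coinduced module Hom_eLe(Le, X), whose elements are extended to L by
   f l = f (l e). *)
Definition coind : Type := {f : L -> X | is_coind f}.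
HB.instance Definition _ := SubType.on coind.
HB.instance Definition _ := Choice.on coind.
HB.instance Definition _ := [SubChoice_isSubZmodule of coind by <:].

Lemma coind_scale_subproof (a : L^c) (f : coind) :
  is_coind (fun l => val f ((a : L) * l)).
Proof.
have /asboolP[fB fM] := valP f; apply/asboolP; split=> [x y|l b].
  by rewrite mulrBr fB.
by rewrite mulrA fM.
Qed.

Definition coind_scale (a : L^c) (f : coind) : coind :=
  Sub (fun l => val f ((a : L) * l)) (coind_scale_subproof a f).

Lemma coind_scaleA a b f :
  coind_scale a (coind_scale b f) = coind_scale (a * b) f.
Proof. by apply: val_inj; apply/funext => l /=; rewrite mulrA. Qed.
Lemma coind_scale1 : left_id 1 coind_scale.
Proof. by move=> f; apply: val_inj; apply/funext => l /=; rewrite mul1r. Qed.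
Lemma coind_scaleDr : right_distributive coind_scale +%R.
Proof. by move=> a f g; exact: val_inj. Qed.
Lemma coind_scaleDl f : {morph coind_scale^~ f : a b / a + b}.
Proof.
move=> a b; apply: val_inj; apply/funext => l /=.
have /asboolP[fB _] := valP f.
have fN x : val f (- x) = - val f x.
  by have f0 := fB 0 0; rewrite !subrr in f0; rewrite -sub0r fB f0 sub0r.
by rewrite mulrDl -{1}[(b : L) * l]opprK fB fN opprK.
Qed.

HB.instance Definition _ := GRing.Zmodule_isLmodule.Build L^c coind
  coind_scaleA coind_scale1 coind_scaleDr coind_scaleDl.

Lemma coind_of_subproof (x : X) :
  is_coind (fun l => (to_corner l : eLe^c) *: x).
Proof.
apply/asboolP; split=> [l m|l a].
  rewrite -scalerBl; congr (_ *: x); apply: val_inj.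
  by rewrite /= mulrBr mulrBl.
rewrite scalerA; congr (_ *: x); apply: val_inj.
by rewrite /= -!mulrA corner_r corner_l.
Qed.

(** The map l -> x(ele); these turn out to be exactly the elements of the coinduced module fixed by
    [e]. *)
Definition coind_of (x : X) : coind := Sub _ (coind_of_subproof x).

Lemma coind_of_zmod_morphism : zmod_morphism coind_of.
Proof.
by move=> x y; apply: val_inj; apply/funext => l; rewrite /= scalerBr.
Qed.

HB.instance Definition _ :=
  GRing.isZmodMorphism.Build X coind coind_of coind_of_zmod_morphism.

Lemma coind_ofZ (a : eLe^c) x :
  coind_of (a *: x) = (val (a : eLe) : L^c) *: coind_of x.
Proof.
apply: val_inj; apply/funext => l; rewrite /= scalerA; congr (_ *: x).
exact: to_corner_mul.
Qed.

Lemma coind_of_e x : (e : L^c) *: coind_of x = coind_of x.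
Proof. by apply: val_inj; apply/funext => l; rewrite /= to_corner_eM. Qed.

(** Being fixed gives f(el) = f(l), and the unit of the corner gives f(le) = f(l), so f(l) = f(ele)
    = f(1)(ele). *)
Lemma coind_fixed (f : coind) : (e : L^c) *: f = f ->
  f = coind_of (val f 1).
Proof.
move=> fe; have /asboolP[_ fM] := valP f.
have fer l : val f (l * e) = val f l by have := fM l 1; rewrite scale1r.
have fel l : val f (e * l) = val f l by rewrite -[in RHS]fe.
by apply: val_inj; apply/funext => l; rewrite /= -fM mul1r /= fer fel.
Qed.

End Coinduction.

(** Over an arbitrary ring the coinduced module need not be finitely generated, so [M] is its
    submodule spanned by the images of generators of [X]. It contains every [coind_of x], and its
    elements fixed by [e] all have this form; evaluation at 1 recovers [x]. *)
Lemma mul_e_fin_gen_surj (X : rmodType eLe) : fin_gen X ->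
  exists2 M : rmodType L, fin_gen M & lmod_iso (mul_e he M) X.
Proof.
move=> [s sX]; pose S := map (@coind_of X) s; pose M := span S.
exists M; first exact: span_fin_gen.
have coind_of_span x : in_span S (coind_of x).
  have [c ->] := sX x; apply/asboolP; exists (fun i => val (c i : eLe)).
  rewrite raddf_sum size_map; apply: eq_bigr => i _.
  by rewrite (nth_map 0) //; exact: coind_ofZ.
(* The three projections pass from the corner module to the span, to the coinduced module and to the
   underlying function. *)
pose phi (m : mul_e he M) : X := val (val (val m)) 1.
have phi_linear : linear phi.
  move=> a m n; rewrite /phi /= fctE mulr1; congr (_ + _).
  have /asboolP[_ fM] := valP (val (val m)).
  by rewrite -fM mul1r.
have psi_subproof x : in_Me e (Sub (coind_of x) (coind_of_span x) : M).
  by apply/eqP; apply: val_inj; exact: coind_of_e.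
pose psi x : mul_e he M := Sub _ (psi_subproof x).
have psi_linear : linear psi.
  move=> a x y; do 2!apply: val_inj; rewrite /= raddfD /=; congr (_ + _).
  exact: coind_ofZ.
pose phiL : {linear mul_e he M -> X} :=
  HB.pack phi (GRing.isLinear.Build _ _ _ _ phi phi_linear).
pose psiL : {linear X -> mul_e he M} :=
  HB.pack psi (GRing.isLinear.Build _ _ _ _ psi psi_linear).
exists phiL, psiL; split=> [m|x].
  do 2!apply: val_inj; apply/esym/coind_fixed.
  by have /eqP/(congr1 val) := valP m.
by rewrite /phiL /= /phi /= to_corner1 scale1r.
Qed.

End Corner.

Theorem corollary5p12 (R : comPzRingType) (L : pzRingType)
    (iota : {rmorphism R -> L}) (e : L) (he : e * e = e) (t : nat) :
  artin_algebra iota ->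
  t_ev_hom_iso (mul_e he) t ->
  [/\ (rfin_dim (corner he) <= maxe (rfin_dim L) (t%:Z)%:E)%E,
      (rfin_dim L <= maxe (rfin_dim (corner he)) (t%:Z)%:E)%E &
      (rfin_dim L < +oo)%E <-> (rfin_dim (corner he) < +oo)%E].
Proof.
move=> _ [E_iso _].
have le_corner := ev_hom_iso_fin_dim_le E_iso (@mul_e_fin_gen_surj _ _ he).
have ge_corner := ev_hom_iso_fin_dim_ge E_iso (@mul_e_fin_gen_surj _ _ he).
split=> //; split=> fin.
  by apply: le_lt_trans le_corner _; rewrite gt_max fin ltry.
by apply: le_lt_trans ge_corner _; rewrite gt_max fin ltry.
Qed.
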